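(* Let $\mathbf{x}[n]=[I_1[n],Q_1[n],I_2[n],Q_2[n]]^{\mathsf T}\in\mathbb{R}^4$, $n=1,\dots,N$, be $N$ independent samples of a zero-mean Gaussian random vector with covariance matrix $\mathbf\Sigma(\sigma_1,\sigma_2,\rho,\phi)$ of the structured form given in the context (QTMS radar case or standard noise radar case). In terms of the sample means $\bar P_1,\bar P_2,\bar R_c,\bar R_s$ defined in the context, the minimum Frobenius norm (MFN) estimators and the maximum likelihood (ML) estimators of the four parameters $\sigma_1,\sigma_2,\rho,\phi$ coincide, and both are given by $$\hat\sigma_1=\sqrt{\frac{\bar P_1}{2}},\qquad \hat\sigma_2=\sqrt{\frac{\bar P_2}{2}},\qquad \hat\rho=\sqrt{\frac{\bar R_c^2+\bar R_s^2}{\bar P_1\bar P_2}},\qquad \hat\phi=\operatorname{atan2}(\bar R_s,\bar R_c),$$ where $\operatorname{atan2}(y,x)$ is the two-argument arctangent.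
   Context: The structured covariance matrix is the real $4\times4$ block matrix $$\mathbf\Sigma(\sigma_1,\sigma_2,\rho,\phi)=\begin{bmatrix}\sigma_1^2\mathbf 1_2 & \rho\sigma_1\sigma_2\mathbf M(\phi)\\ \rho\sigma_1\sigma_2\mathbf M(\phi)^{\mathsf T}&\sigma_2^2\mathbf 1_2\end{bmatrix},$$ where $\mathbf 1_2$ is the $2\times2$ identity and, in the QTMS (quantum two-mode squeezing) radar case, $\mathbf M(\phi)=\begin{bmatrix}\cos\phi&\sin\phi\\ \sin\phi&-\cos\phi\end{bmatrix}$, while in the standard noise radar case $\mathbf M(\phi)=\begin{bmatrix}\cos\phi&\sin\phi\\-\sin\phi&\cos\phi\end{bmatrix}$. The parameters satisfy $\sigma_1\ge0$, $\sigma_2\ge0$, $0\le\rho\le1$. An overline denotes the sample mean over $n=1,\dots,N$. The sample covariance matrix is $\hat{\mathbf S}=\overline{\mathbf x\mathbf x^{\mathsf T}}=\frac1N\sum_{n=1}^N\mathbf x[n]\mathbf x[n]^{\mathsf T}$. The auxiliary quantities are $$P_1=I_1^2+Q_1^2,\quad P_2=I_2^2+Q_2^2,\quad R_c=I_1I_2\mp Q_1Q_2,\quad R_s=I_1Q_2\pm I_2Q_1,$$ with the upper signs in the QTMS radar case and the lower signs in the standard noise radar case; $\bar P_1,\bar P_2,\bar R_c,\bar R_s$ are their sample means. The MFN estimators are the arguments $(\sigma_1,\sigma_2,\rho,\phi)$ which minimize $\bigl\|\mathbf\Sigma(\sigma_1,\sigma_2,\rho,\phi)-\hat{\mathbf S}\bigr\|_F$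 (Frobenius norm) subject to $0\le\sigma_1$, $0\le\sigma_2$, $0\le\rho\le1$. The ML estimators are the arguments which maximize, subject to the same constraints, the Gaussian log-likelihood $$\ell(\mathbf\Sigma)=-\frac N2\left(\ln|\mathbf\Sigma|+4\ln(2\pi)+\overline{\mathbf x^{\mathsf T}\mathbf\Sigma^{-1}\mathbf x}\right),\qquad \mathbf\Sigma=\mathbf\Sigma(\sigma_1,\sigma_2,\rho,\phi),$$ where $|\mathbf\Sigma|$ is the determinant.
   Formalization: Formulas must be defined (P̄1, P̄2 ≠ 0, (R̄c, R̄s) ≠ (0,0)), with ρ̂ < 1 for ML; a.s. true if σ1, σ2 > 0, and for ML also ρ < 1, N ≥ 2 (else ρ̂ is 0/0 or the likelihood is unbounded). ML is over nonsingular Σ; φ is modulo 2π. *)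

(* Defs.v *)
(* MathComp-Analysis. *)
From HB Require Import structures.
From mathcomp Require Import all_boot all_order all_algebra.
From mathcomp Require Import all_classical all_reals all_analysis.
Set Implicit Arguments.
Unset Strict Implicit.
Unset Printing Implicit Defensive.
Import Order.TTheory GRing.Theory Num.Theory.
Import numFieldNormedType.Exports.
Local Open Scope classical_set_scope.
Local Open Scope ring_scope.

Inductive radar := QTMS | StandardNoise.

Record params (R : realType) :=
  Params { sigma1 : R; sigma2 : R; rho : R; phi : R }.

Section covariance.
Context {R : realType}.

Definition mx22 (a b c d : R) : 'M[R]_2 :=
  \matrix_(i, j) nth 0 (nth [::] [:: [:: a; b]; [:: c; d]] i) j.

Definition Mphi (c : radar) (t : R) : 'M[R]_2 :=
  match c with
  | QTMS => mx22 (cos t) (sin t) (sin t) (- cos t)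
  | StandardNoise => mx22 (cos t) (sin t) (- sin t) (cos t)
  end.

Definition Sigma (c : radar) (th : params R) : 'M[R]_4 :=
  let B := (rho th * sigma1 th * sigma2 th) *: Mphi c (phi th) in
  block_mx ((sigma1 th ^+ 2)%:M : 'M[R]_2) B
           B^T ((sigma2 th ^+ 2)%:M : 'M[R]_2).

Definition feasible (th : params R) : Prop :=
  [/\ 0 <= sigma1 th, 0 <= sigma2 th, 0 <= rho th & rho th <= 1].

End covariance.

Section estimators.
Context {R : realType} {N : nat}.
Implicit Types (c : radar) (x : 'I_N -> 'cV[R]_4).

Definition mean (f : 'I_N -> R) : R := (\sum_(n < N) f n) / N%:R.

Definition I1 (v : 'cV[R]_4) : R := v (inord 0) 0.
Definition Q1 (v : 'cV[R]_4) : R := v (inord 1) 0.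
Definition I2 (v : 'cV[R]_4) : R := v (inord 2) 0.
Definition Q2 (v : 'cV[R]_4) : R := v (inord 3) 0.

Definition P1bar x : R := mean (fun n => I1 (x n) ^+ 2 + Q1 (x n) ^+ 2).
Definition P2bar x : R := mean (fun n => I2 (x n) ^+ 2 + Q2 (x n) ^+ 2).

Definition Rcbar c x : R := mean (fun n =>
  match c with
  | QTMS => I1 (x n) * I2 (x n) - Q1 (x n) * Q2 (x n)
  | StandardNoise => I1 (x n) * I2 (x n) + Q1 (x n) * Q2 (x n)
  end).

Definition Rsbar c x : R := mean (fun n =>
  match c with
  | QTMS => I1 (x n) * Q2 (x n) + I2 (x n) * Q1 (x n)
  | StandardNoise => I1 (x n) * Q2 (x n) - I2 (x n) * Q1 (x n)
  end).

Definition sample_cov x : 'M[R]_4 :=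
  N%:R^-1 *: \sum_(n < N) (x n *m (x n)^T).

Definition frobenius_norm m n (A : 'M[R]_(m, n)) : R :=
  Num.sqrt (\sum_i \sum_j A i j ^+ 2).

Definition mfn_estimators c x : set (params R) :=
  [set th | feasible th /\ forall th', feasible th' ->
    frobenius_norm (Sigma c th - sample_cov x)
      <= frobenius_norm (Sigma c th' - sample_cov x)].

Definition log_likelihood x (S : 'M[R]_4) : R :=
  - (N%:R / 2) * (ln (\det S) + 4 * ln (2 * pi)
    + mean (fun n => ((x n)^T *m invmx S *m x n) 0 0)).

(* For a singular matrix ln (\det S) and S^-1, hence the log-likelihood, are
   undefined mathematically (ln 0 = 0 and invmx S = S in the library), so the
   maximization ranges over the parameters with nonsingular covariance. *)
Definition ml_estimators c x : set (params R) :=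
  [set th | [/\ feasible th, Sigma c th \in unitmx &
    forall th', feasible th' -> Sigma c th' \in unitmx ->
      log_likelihood x (Sigma c th') <= log_likelihood x (Sigma c th)]].

(* Principal value in ]-pi, pi]; the value 0 at the origin is a dummy. *)
Definition atan2 (b a : R) : R :=
  if 0 < a then atan (b / a)
  else if a < 0 then (if 0 <= b then atan (b / a) + pi else atan (b / a) - pi)
  else if 0 < b then pi / 2
  else if b < 0 then - (pi / 2)
  else 0.

Definition sigma1_hat x : R := Num.sqrt (P1bar x / 2).
Definition sigma2_hat x : R := Num.sqrt (P2bar x / 2).
Definition rho_hat c x : R :=
  Num.sqrt ((Rcbar c x ^+ 2 + Rsbar c x ^+ 2) / (P1bar x * P2bar x)).
Definition phi_hat c x : R := atan2 (Rsbar c x) (Rcbar c x).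

(* phi ranges over all of R in both optimizations and Sigma is 2pi-periodic in
   phi, so an estimate of phi is an angle, known up to a multiple of 2pi. *)
Definition closed_form c x : set (params R) :=
  [set th | [/\ sigma1 th = sigma1_hat x, sigma2 th = sigma2_hat x,
    rho th = rho_hat c x &
    exists k : int, phi th = phi_hat c x + k%:~R * (2 * pi)]].

(* The fraction in rho_hat and the angle atan2 are both meaningful. *)
Definition closed_form_defined c x : Prop :=
  [/\ P1bar x != 0, P2bar x != 0 & (Rcbar c x, Rsbar c x) != (0, 0)].

End estimators.

Section gaussian.
Context {d : measure_display} {T : measurableType d} {R : realType}.
Variable P : probability T R.

Definition col_of_tuple m (t : m.-tuple R) : 'cV[R]_m := \col_i tnth t i.

(* Joint law of four independent standard normal variables. *)
Definition std_normal4 : set (R * R * R * R) -> \bar R :=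
  (((normal_prob 0 1 \x normal_prob 0 1) \x normal_prob 0 1)
     \x normal_prob 0 1)%E.

(* X is distributed as A Z with Z standard normal and A A^T = S; unlike the
   definition by a density, this also covers a singular S. *)
Definition centered_gaussian (X : {RV P >-> 4.-tuple R}) (S : 'M[R]_4) : Prop :=
  exists2 A : 'M[R]_4, A *m A^T = S &
  forall B : set (4.-tuple R), measurable B ->
    distribution P X B = std_normal4 [set z |
      B [tuple (A *m col_of_tuple [tuple z.1.1.1; z.1.1.2; z.1.2; z.2]) i 0
        | i < 4]].

(* The product rule for a subfamily is obtained with B n = setT elsewhere. *)
Definition independent_samples N (X : 'I_N -> {RV P >-> 4.-tuple R}) : Prop :=
  forall B : 'I_N -> set (4.-tuple R), (forall n, measurable (B n)) ->
    P [set w | forall n, B n (X n w)]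
      = (\prod_(n < N) P (X n @^-1` B n))%E.

Definition observation N (X : 'I_N -> {RV P >-> 4.-tuple R}) (w : T) :
    'I_N -> 'cV[R]_4 :=
  fun n => col_of_tuple (X n w).

End gaussian.

(* Main.v *)
(* With a = sigma1^2, b = sigma2^2 and u = rho sigma1 sigma2 e^(i phi), the
   squared Frobenius distance is, up to a constant,
   2 (a - P1/2)^2 + 2 (b - P2/2)^2 + 4 |u - R/2|^2, where R = Rc + i Rs, so the
   MFN estimator matches moments; it is feasible by Cauchy-Schwarz.
   The log-likelihood depends on D = a b - |u|^2 and on a trace; its defect with
   respect to the moment-matching parameters is Stein's loss of two 2 x 2
   Hermitian matrices, which is nonnegative by ln t <= t - 1, with equality only
   for equal matrices.
   The almost sure part follows from Fubini: a polynomial that is not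
   identically zero on the range of the covariance is almost surely nonzero. To
   get R != 0 this is applied to the component of R in direction phi,
   conditionally on all samples but one, and to get rho_hat < 1 it is applied
   to a 2 x 2 minor built from two samples. *)
Require Import Defs.
From HB Require Import structures.
From mathcomp Require Import all_boot all_order all_algebra.
From mathcomp Require Import all_classical all_reals all_analysis.
From mathcomp Require Import measurable_realfun ring lra.
Set Implicit Arguments.
Unset Strict Implicit.
Unset Printing Implicit Defensive.
Import Order.TTheory GRing.Theory Num.Theory.
Import numFieldNormedType.Exports.
Local Open Scope classical_set_scope.
Local Open Scope ring_scope.

(** * Angles *)

Section angles.
Context {R : realType}.
Implicit Types (a b x y : R).

Lemma cosDkpi x (k : int) : cos (x + k%:~R * (2 * pi)) = cos x.
Proof.
have H n y : cos (y + n%:R * (2 * pi)) = cos y.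
  elim: n => [|n IH]; first by rewrite mul0r addr0.
  by rewrite -natr1 mulrDl mul1r addrA [X in _ + X]mulr_natl cosD2pi IH.
case: k => n; first exact: H.
by rewrite NegzE mulrNz mulNr -(H n.+1) subrK.
Qed.

Lemma sinDkpi x (k : int) : sin (x + k%:~R * (2 * pi)) = sin x.
Proof.
have H n y : sin (y + n%:R * (2 * pi)) = sin y.
  elim: n => [|n IH]; first by rewrite mul0r addr0.
  by rewrite -natr1 mulrDl mul1r addrA [X in _ + X]mulr_natl sinD2pi IH.
case: k => n; first exact: H.
by rewrite NegzE mulrNz mulNr -(H n.+1) subrK.
Qed.

(** The remainder [z] of [x - y] modulo [2 * pi] satisfies [cos z = 1], hence [sin (z / 2) = 0].
    Since [z / 2] lies in [0, pi[, where the sine vanishes only at 0, [z] is 0. *)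
Lemma cos_sin_inj x y : cos x = cos y -> sin x = sin y ->
  exists k : int, x = y + k%:~R * (2 * pi).
Proof.
move=> hc hs; exists (Num.floor ((x - y) / (2 * pi))).
set k := Num.floor _; have pi0 : 0 < pi :> R := pi_gt0 R.
have pi20 : 0 < 2 * pi :> R by lra.
have /andP[k1 k2] := floor_itv ((x - y) / (2 * pi)).
rewrite -/k in k1 k2.
rewrite ler_pdivlMr // in k1; rewrite ltr_pdivrMr // intrD mulrDl mul1r in k2.
set z := x - y - k%:~R * (2 * pi).
have cz : cos z = 1.
  rewrite /z -mulNr -mulrNz cosDkpi cosB hc hs -!expr2; exact: cos2Dsin2.
suff z0 : z = 0 by move: z0; rewrite /z; lra.
have : cos (z / 2 + z / 2) = 1 by rewrite -splitr.
rewrite cosD -!expr2 => c1.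
have /eqP : sin (z / 2) ^+ 2 = 0 by have := cos2Dsin2 (z / 2); lra.
rewrite sqrf_eq0 => /eqP s0.
case: (ltrP 0 (z / 2)) => zz; last by apply/eqP; rewrite eq_le; apply/andP; rewrite /z; split; move: zz; rewrite /z; lra.
have : 0 < sin (z / 2) by apply: sin_gt0_pi; rewrite zz /=; rewrite /z; lra.
by rewrite s0 ltxx.
Qed.

(** For [a != 0] the modulus is |a| sqrt(1 + (b/a)^2), and this root cancels [cos (atan (b / a))].
    For [a < 0] the shift by [pi] compensates the sign of |a|. *)
Lemma polar_atan2 a b : (a, b) != (0, 0) ->
  Num.sqrt (a ^+ 2 + b ^+ 2) * cos (atan2 b a) = a /\
  Num.sqrt (a ^+ 2 + b ^+ 2) * sin (atan2 b a) = b.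
Proof.
have sin_atan t : sin (atan t) = t * cos (atan t) :> R.
  have ct : cos (atan t) != 0 by rewrite gt_eqF // cos_atan invr_gt0 sqrtr_gt0 ltr_pwDl ?sqr_ge0.
  by rewrite -[X in X * _]atanK mulfVK.
have cosE t : Num.sqrt (1 + t ^+ 2) * cos (atan t) = 1 :> R.
  by rewrite cos_atan mulfV // gt_eqF // sqrtr_gt0 ltr_pwDl ?sqr_ge0.
have sqE : a != 0 -> Num.sqrt (a ^+ 2 + b ^+ 2) = `|a| * Num.sqrt (1 + (b / a) ^+ 2).
  move=> a0; rewrite -sqrtr_sqr -sqrtrM ?sqr_ge0 //; congr Num.sqrt; by field.
rewrite /atan2 => ab0; case: ltrgtP => [a0|a0|a0].
- have a0' : a != 0 by rewrite gt_eqF.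
  rewrite sqE // gtr0_norm // sin_atan.
  move: (Num.sqrt _) (cos _) (cosE (b / a)) => q C qC.
  by split; [transitivity (a * (q * C)) | transitivity (b * (q * C))];
    [field | rewrite qC mulr1 | field | rewrite qC mulr1].
- have a0' : a != 0 by rewrite lt_eqF.
  rewrite sqE // ltr0_norm //.
  have -> : cos (if 0 <= b then atan (b / a) + pi else atan (b / a) - pi)
      = - cos (atan (b / a)).
    by case: ifP => _; [rewrite cosD | rewrite cosB]; rewrite cospi sinpi; ring.
  have -> : sin (if 0 <= b then atan (b / a) + pi else atan (b / a) - pi)
      = - sin (atan (b / a)).
    by case: ifP => _; [rewrite sinD | rewrite sinB]; rewrite cospi sinpi; ring.
  rewrite sin_atan; move: (Num.sqrt _) (cos _) (cosE (b / a)) => q C qC.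
  by split; [transitivity (a * (q * C)) | transitivity (b * (q * C))];
    [field | rewrite qC mulr1 | field | rewrite qC mulr1].
- move: ab0; rewrite -a0 expr0n add0r sqrtr_sqr.
  case: ltrgtP => [b0|b0|->]; last by rewrite eqxx.
  + by rewrite cos_pihalf sin_pihalf gtr0_norm // mulr0 mulr1.
  + by rewrite cosN sinN cos_pihalf sin_pihalf ltr0_norm // mulr0 mulrNN mulr1.
Qed.

End angles.

(** * Sample means *)

Section sample_mean.
Context {R : realType} {N : nat}.
Implicit Types f g : 'I_N -> R.

Lemma eq_mean f g : f =1 g -> mean f = mean g.
Proof. by move=> fg; rewrite /mean; congr (_ / _); apply: eq_bigr. Qed.

Lemma meanD f g : mean (fun n => f n + g n) = mean f + mean g.
Proof. by rewrite /mean big_split mulrDl. Qed.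

Lemma meanZ k f : mean (fun n => k * f n) = k * mean f.
Proof. by rewrite /mean -mulr_sumr mulrA. Qed.

Lemma mean_ge0 f : (forall n, 0 <= f n) -> 0 <= mean f.
Proof. by move=> f0; rewrite divr_ge0 // sumr_ge0. Qed.

Lemma mean_eq0 f : (0 < N)%N -> (forall n, 0 <= f n) -> mean f = 0 ->
  forall n, f n = 0.
Proof.
move=> N0 f0 /eqP; rewrite mulf_eq0 invr_eq0 pnatr_eq0 eqn0Ngt N0 orbF.
by rewrite psumr_eq0 => [/allP H n|n _]; [apply/eqP/H; rewrite mem_index_enum|].
Qed.

End sample_mean.

(** * Entries, determinant and inverse of the covariance *)

Section covariance_entries.
Context {R : realType}.
Implicit Types (c : radar) (th : params R) (v w : 'cV[R]_4).

(** With z1 = I1 + i Q1 and z2 = I2 + i Q2, [rc] and [rs] are the real and imaginary parts of z1 z2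
    for QTMS and of conj(z1) z2 for standard noise. *)
Definition rc c v : R :=
  match c with
  | QTMS => I1 v * I2 v - Q1 v * Q2 v
  | StandardNoise => I1 v * I2 v + Q1 v * Q2 v
  end.

Definition rs c v : R :=
  match c with
  | QTMS => I1 v * Q2 v + I2 v * Q1 v
  | StandardNoise => I1 v * Q2 v - I2 v * Q1 v
  end.

Definition cross th : R := rho th * sigma1 th * sigma2 th.

(** Determinant of the 2 x 2 Hermitian matrix [[sigma1^2, u], [u^*, sigma2^2]] with |u| =
    [cross]. *)
Definition gram_det th : R :=
  sigma1 th ^+ 2 * sigma2 th ^+ 2 - cross th ^+ 2.

Lemma sum4 (F : 'I_4 -> R) :
  \sum_i F i = F (inord 0) + F (inord 1) + F (inord 2) + F (inord 3).
Proof.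
rewrite !big_ord_recl big_ord0 addr0 !addrA.
by do ![congr (_ + _)]; congr F; apply/val_inj; rewrite /= inordK.
Qed.

Lemma ord4P (Q : 'I_4 -> Prop) :
  Q (inord 0) -> Q (inord 1) -> Q (inord 2) -> Q (inord 3) -> forall i, Q i.
Proof.
move=> q0 q1 q2 q3 i; rewrite -(inord_val i).
by case: i => -[|[|[|[|]]]].
Qed.

Definition mx44 (e : seq (seq R)) : 'M[R]_4 :=
  \matrix_(i, j) nth 0 (nth [::] e i) j.

Lemma mx44E e i j : (i < 4)%N -> (j < 4)%N ->
  mx44 e (inord i) (inord j) = nth 0 (nth [::] e i) j.
Proof. by move=> i4 j4; rewrite mxE !inordK. Qed.

(** The coefficients are left free so that the family also contains the inverses of its invertible
    members. *)
Definition block44 c (a b r t : R) : 'M[R]_(2 + 2) :=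
  block_mx (a%:M : 'M[R]_2) (r *: Mphi c t) (r *: Mphi c t)^T (b%:M : 'M[R]_2).

Lemma block44E c (a b r t : R) : block44 c a b r t =
  let C := r * cos t in let S := r * sin t in
  match c with
  | QTMS => mx44 [:: [:: a; 0; C; S]; [:: 0; a; S; - C];
                     [:: C; S; b; 0]; [:: S; - C; 0; b]]
  | StandardNoise => mx44 [:: [:: a; 0; C; S]; [:: 0; a; - S; C];
                              [:: C; - S; b; 0]; [:: S; C; 0; b]]
  end.
Proof.
apply/matrixP => i j; case: c => /=; rewrite /block44 /mx44 !mxE.
all: case: splitP => i' ->; rewrite !mxE; case: splitP => j' ->; rewrite !mxE.
all: case: i' => -[|[|//]] Hi; case: j' => -[|[|//]] Hj; rewrite ?eqE /= ?mulr1n ?mulr0n //=.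
all: by rewrite mulrN.
Qed.

Lemma SigmaE c th :
  Sigma c th = block44 c (sigma1 th ^+ 2) (sigma2 th ^+ 2) (cross th) (phi th).
Proof. by []. Qed.

Lemma Mphi_trmxK c t : Mphi c t *m (Mphi c t)^T = 1%:M :> 'M[R]_2.
Proof.
have ct := cos2Dsin2 t.
apply/matrixP => i j; rewrite !mxE !big_ord_recl big_ord0 addr0 !mxE.
by case: c; case: i => -[|[|//]] Hi; case: j => -[|[|//]] Hj;
  rewrite !mxE /= ?eqE /= ?mulr1n ?mulr0n -?ct; ring.
Qed.

Lemma Mphi_trmxKV c t : (Mphi c t)^T *m Mphi c t = 1%:M :> 'M[R]_2.
Proof. exact/mulmx1C/Mphi_trmxK. Qed.

(** As [Mphi] is orthogonal, the blocks multiply like [[a, r], [r, b]] and its adjugate. *)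
Lemma block44_mulV c (a b r t : R) :
  block44 c a b r t *m block44 c b a (- r) t = (a * b - r ^+ 2)%:M.
Proof.
suff -> : block44 c a b r t *m block44 c b a (- r) t =
    block_mx ((a * b - r ^+ 2)%:M : 'M[R]_2) 0 0 ((a * b - r ^+ 2)%:M : 'M[R]_2).
  by rewrite -scalar_mx_block.
rewrite /block44 mulmx_block -!scalar_mxM; congr block_mx.
- rewrite [(_ *: _)^T]linearZ /= -scalemxAl -scalemxAr Mphi_trmxK !scalerA scalemx1 -raddfD.
  by congr _%:M; rewrite /=; ring.
- by rewrite mul_scalar_mx mul_mx_scalar !scalerA -scalerDl mulrN addNr scale0r.
- by rewrite mul_scalar_mx mul_mx_scalar !linearZ /= !scalerA -scalerDl mulNr subrr scale0r.
- rewrite [(_ *: _)^T]linearZ /= -scalemxAl -scalemxAr Mphi_trmxKV !scalerA scalemx1 -raddfD.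
  by congr _%:M; rewrite /=; ring.
Qed.

(** Schur complement: right multiplication by [U] clears the lower left block. The factor det U =
    b^2 then has to be cancelled, whence [b != 0]. *)
Lemma det_block44 c (a b r t : R) : b != 0 ->
  \det (block44 c a b r t) = (a * b - r ^+ 2) ^+ 2.
Proof.
move=> b0; pose U : 'M[R]_(2 + 2) :=
  block_mx (b%:M : 'M[R]_2) 0 ((- r) *: Mphi c t)^T (1%:M : 'M[R]_2).
have : \det (block44 c a b r t *m U) =
    \det ((a * b - r ^+ 2)%:M : 'M[R]_2) * \det (b%:M : 'M[R]_2).
  rewrite -(@det_ublock _ 2 2 _ (r *: Mphi c t)); congr (\det _).
  rewrite /block44 /U mulmx_block -!scalar_mxM !mulmx1 !mulmx0 !add0r.
  congr block_mx.
  - rewrite [(_ *: _)^T]linearZ /= -scalemxAl -scalemxAr Mphi_trmxK !scalerA scalemx1 -raddfD.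
    by congr _%:M; rewrite /=; ring.
  - rewrite mul_scalar_mx mul_mx_scalar !linearZ /= !scalerA -scalerDl.
    by rewrite mulNr subrr scale0r.
  - by rewrite mulr1.
rewrite det_mulmx det_lblock !det_scalar expr1n mulr1.
by move=> /mulIf; apply; rewrite expf_neq0.
Qed.

Lemma block44_unit c (a b r t : R) :
  ((block44 c a b r t : 'M[R]_4) \in unitmx) = (a * b - r ^+ 2 != 0).
Proof.
have E := block44_mulV c a b r t; apply/idP/idP => [u|D0].
  (* An invertible matrix whose product with [block44 c b a (- r) t] is 0 forces that factor to
     vanish; so [a], [b] and [r] are 0, a contradiction. *)
  apply/eqP => D0; move: E; rewrite D0 raddf0 => /(congr1 (mulmx (invmx (block44 c a b r t)))).
  rewrite mulmx0 mulKmx // => /eqP; rewrite /block44 block_mx_eq0.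
  move=> /and4P[/eqP/matrixP/(_ 0 0) + _ _ /eqP/matrixP/(_ 0 0)].
  rewrite !mxE !mulr1n => b0 a0; move: D0; rewrite a0 b0 mulr0 sub0r.
  move/eqP; rewrite oppr_eq0 sqrf_eq0 => /eqP r0; move: u.
  by rewrite /block44 a0 b0 r0 !scale0r !raddf0 /= block_mx0 unitmxE det0 unitr0.
suff : block44 c a b r t *m ((a * b - r ^+ 2)^-1 *: block44 c b a (- r) t) = 1%:M.
  by case/mulmx1_unit.
by rewrite -scalemxAr E scale_scalar_mx mulVf.
Qed.

Lemma invmx_block44 c (a b r t : R) : a * b - r ^+ 2 != 0 ->
  invmx (block44 c a b r t : 'M[R]_4)
    = (a * b - r ^+ 2)^-1 *: (block44 c b a (- r) t : 'M[R]_4).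
Proof.
move=> D0; have := D0; rewrite -(block44_unit c _ _ _ t) => u.
have E : block44 c a b r t *m block44 c b a (- r) t = (a * b - r ^+ 2)%:M :> 'M[R]_4 := block44_mulV c a b r t.
apply: (can_inj (mulKmx u)); rewrite mulmxV // -scalemxAr E.
by rewrite scale_scalar_mx mulVf.
Qed.

Lemma quad_block44 c (a b r t : R) v :
  (v^T *m (block44 c a b r t : 'M[R]_4) *m v) 0 0 =
  a * (I1 v ^+ 2 + Q1 v ^+ 2) + b * (I2 v ^+ 2 + Q2 v ^+ 2)
    + 2 * (r * cos t) * rc c v + 2 * (r * sin t) * rs c v.
Proof.
rewrite block44E !mxE sum4 !mxE !sum4.
by case: c; rewrite /= !mx44E // !mxE /= /rc /rs /I1 /I2 /Q1 /Q2; ring.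
Qed.

End covariance_entries.

(** * Minimum Frobenius norm and maximum likelihood *)

Section estimators.
Context {R : realType} {N : nat}.
Implicit Types (c : radar) (x : 'I_N -> 'cV[R]_4) (th : params R).

Lemma meanB (f g : 'I_N -> R) : mean (fun n => f n - g n) = mean f - mean g.
Proof. by rewrite /mean sumrB mulrBl. Qed.

(** * Cauchy-Schwarz for the sample moments and the closed form *)

Lemma P1bar_ge0 x : 0 <= P1bar x.
Proof. by apply: mean_ge0 => n; rewrite addr_ge0 ?sqr_ge0. Qed.

Lemma P2bar_ge0 x : 0 <= P2bar x.
Proof. by apply: mean_ge0 => n; rewrite addr_ge0 ?sqr_ge0. Qed.

(** Sign given to Q1 by the conjugation of z1 for standard noise; one formula then serves both
    radars. *)
Definition twist c : R := if c is QTMS then 1 else - 1.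

(* In complex notation z1 = I1 + i Q1 (conjugated for the standard noise
   radar), z2 = I2 + i Q2 and r = Rc + i Rs, these are the two components of
   P1 z2 - conj(z1) r, the residual in the Cauchy-Schwarz inequality. *)
Definition residual_re c (p1 r s : R) (v : 'cV[R]_4) : R :=
  p1 * I2 v - (I1 v * r + twist c * Q1 v * s).
Definition residual_im c (p1 r s : R) (v : 'cV[R]_4) : R :=
  p1 * Q2 v - (I1 v * s - twist c * Q1 v * r).

(** Expanding the square writes the Cauchy-Schwarz defect as a mean of squares, which yields both
    the inequality and its equality case. *)
Lemma mean_residual c x (p1 := P1bar x) (r := Rcbar c x) (s := Rsbar c x) :
  mean (fun n => residual_re c p1 r s (x n) ^+ 2
                 + residual_im c p1 r s (x n) ^+ 2)
  = p1 * (p1 * P2bar x - (r ^+ 2 + s ^+ 2)).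
Proof.
transitivity (mean (fun n =>
   p1 ^+ 2 * (I2 (x n) ^+ 2 + Q2 (x n) ^+ 2)
   + (r ^+ 2 + s ^+ 2) * (I1 (x n) ^+ 2 + Q1 (x n) ^+ 2)
   - (2 * p1 * r * rc c (x n) + 2 * p1 * s * rs c (x n)))).
  apply: eq_mean => n; rewrite /residual_re /residual_im /twist /rc /rs.
  by case: (c); ring.
rewrite meanB 2!meanD 4!meanZ -/(P1bar x) -/(P2bar x).
rewrite -/(Rcbar c x) -/(Rsbar c x) -/p1 -/r -/s; ring.
Qed.

Lemma Rbar_le_Pbar c x : P1bar x != 0 ->
  Rcbar c x ^+ 2 + Rsbar c x ^+ 2 <= P1bar x * P2bar x.
Proof.
move=> P0; have Pp : 0 < P1bar x by rewrite lt_def P0 P1bar_ge0.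
rewrite -subr_ge0 -(pmulr_rge0 _ Pp) -mean_residual.
by apply: mean_ge0 => n; rewrite addr_ge0 ?sqr_ge0.
Qed.

(** Cartesian coordinates of u = cross e^(i phi) replace the polar ones; this form links each
    optimization problem to [closed_form]. *)
Definition moments_match c x th : Prop :=
  [/\ sigma1 th ^+ 2 = P1bar x / 2, sigma2 th ^+ 2 = P2bar x / 2,
      cross th * cos (phi th) = Rcbar c x / 2 &
      cross th * sin (phi th) = Rsbar c x / 2].

Lemma rho_hat_le1 c x : P1bar x != 0 -> P2bar x != 0 -> rho_hat c x <= 1.
Proof.
move=> P10 P20; have := P1bar_ge0 x; have := P2bar_ge0 x => p2 p1.
have P12 : 0 < P1bar x * P2bar x by rewrite mulr_gt0 // lt_def ?P10 ?P20.
by rewrite /rho_hat -[leRHS]sqrtr1 ler_wsqrtr // ler_pdivrMr // mul1r Rbar_le_Pbar.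
Qed.

(** Since R is nonzero, the angle of u is determined up to a period; nonnegativity of [sigma1],
    [sigma2] and [rho] selects the square roots. *)
Lemma closed_formP c x th : closed_form_defined c x ->
  closed_form c x th <-> feasible th /\ moments_match c x th.
Proof.
move=> [P10 P20 R0]; have p1 := P1bar_ge0 x; have p2 := P2bar_ge0 x.
have p1' : 0 < P1bar x by rewrite lt_def P10.
have p2' : 0 < P2bar x by rewrite lt_def P20.
have P12 : 0 < P1bar x * P2bar x by rewrite mulr_gt0.
have RR : 0 < Rcbar c x ^+ 2 + Rsbar c x ^+ 2.
  rewrite lt_def addr_ge0 ?sqr_ge0 // andbT paddr_eq0 ?sqr_ge0 // !sqrf_eq0.
  by move: R0; rewrite xpair_eqE.
have [hc hs] := polar_atan2 R0.
rewrite -/(phi_hat c x) in hc hs.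
have q0 : 0 < Num.sqrt (Rcbar c x ^+ 2 + Rsbar c x ^+ 2) by rewrite sqrtr_gt0.
have qE := sqr_sqrtr (ltW RR).
set q := Num.sqrt _ in hc hs q0 qE.
have crossE s1 s2 r : 0 <= s1 -> 0 <= s2 -> 0 <= r ->
    s1 ^+ 2 = P1bar x / 2 -> s2 ^+ 2 = P2bar x / 2 ->
    r ^+ 2 = q ^+ 2 / (P1bar x * P2bar x) -> r * s1 * s2 = q / 2.
  move=> s10 s20 r0 e1 e2 er; apply/eqP.
  rewrite -(@eqrXn2 _ 2) ?mulr_ge0 //; last exact: ltW.
  by rewrite !exprMn e1 e2 er; apply/eqP; field; rewrite ?P10 ?P20.
split=> [[e1 e2 er [k ek]]|[[s10 s20 r0 r1] [e1 e2 ec es]]].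
  have f1 : sigma1 th ^+ 2 = P1bar x / 2 by rewrite e1 sqr_sqrtr //; lra.
  have f2 : sigma2 th ^+ 2 = P2bar x / 2 by rewrite e2 sqr_sqrtr //; lra.
  have f3 : cross th = q / 2.
    apply: crossE => //; rewrite ?e1 ?e2 ?er ?sqrtr_ge0 //.
    by rewrite sqr_sqrtr ?qE // divr_ge0 // ltW.
  split; first by split; rewrite ?e1 ?e2 ?er ?sqrtr_ge0 // rho_hat_le1.
  split=> //; rewrite f3 ek ?cosDkpi ?sinDkpi.
    by rewrite -hc; ring.
  by rewrite -hs; ring.
(* Adding the squares of the last two moment equations eliminates the angle. *)
have cE : cross th ^+ 2 = q ^+ 2 / 4.
  transitivity ((cross th * cos (phi th)) ^+ 2 + (cross th * sin (phi th)) ^+ 2).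
    by rewrite !exprMn -mulrDr cos2Dsin2 mulr1.
  by rewrite ec es qE; field.
have c0 : 0 <= cross th by rewrite !mulr_ge0.
have f3 : cross th = q / 2.
  apply/eqP; rewrite -(@eqrXn2 _ 2) //; last by rewrite divr_ge0 // ltW.
  by rewrite cE; apply/eqP; field.
have sq u t : 0 <= u -> u ^+ 2 = t -> u = Num.sqrt t.
  by move=> u0 <-; rewrite sqrtr_sqr ger0_norm.
split; [exact: sq | exact: sq | apply: sq => // | ].
  rewrite -qE; apply: (@mulIf _ (P1bar x * P2bar x)); rewrite ?gt_eqF // mulfVK ?gt_eqF //.
  have -> : P1bar x * P2bar x = 4 * (sigma1 th ^+ 2 * sigma2 th ^+ 2).
    by rewrite e1 e2; field.
  by move: cE; rewrite /cross !exprMn; lra.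
apply: cos_sin_inj.
  by apply: (mulfI (lt0r_neq0 q0)); rewrite hc; move: ec; rewrite f3; lra.
by apply: (mulfI (lt0r_neq0 q0)); rewrite hs; move: es; rewrite f3; lra.
Qed.

Lemma closed_form_nonempty c x : closed_form c x !=set0.
Proof.
exists (Params (sigma1_hat x) (sigma2_hat x) (rho_hat c x) (phi_hat c x)).
by split=> //; exists 0; rewrite mul0r addr0.
Qed.

(** * Minimization of the Frobenius distance *)

Lemma sample_covE x i j :
  sample_cov x i j = mean (fun n => x n i 0 * x n j 0).
Proof.
rewrite /sample_cov mxE summxE /mean mulrC; congr (_ / _).
by apply: eq_bigr => n _; rewrite !mxE big_ord1 !mxE.
Qed.

Lemma frobenius_sqr c x : exists K, forall th,
  \sum_i \sum_j (Sigma c th - sample_cov x) i j ^+ 2 =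
  K + 2 * (sigma1 th ^+ 2 - P1bar x / 2) ^+ 2
    + 2 * (sigma2 th ^+ 2 - P2bar x / 2) ^+ 2
    + 4 * (cross th * cos (phi th) - Rcbar c x / 2) ^+ 2
    + 4 * (cross th * sin (phi th) - Rsbar c x / 2) ^+ 2.
Proof.
(* What completing the four squares leaves: the squared distance from the sample covariance to the
   linear span of the structured matrices. *)
exists (\sum_i \sum_j sample_cov x i j ^+ 2 -
  (P1bar x ^+ 2 / 2 + P2bar x ^+ 2 / 2 + Rcbar c x ^+ 2 + Rsbar c x ^+ 2)) => th.
rewrite SigmaE block44E.
have symm i j : sample_cov x i j = sample_cov x j i.
  by rewrite !sample_covE; apply: eq_mean => n; rewrite mulrC.
have -> : P1bar x = sample_cov x (inord 0) (inord 0) + sample_cov x (inord 1) (inord 1).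
  by rewrite !sample_covE -meanD; apply: eq_mean => n; rewrite -!expr2.
have -> : P2bar x = sample_cov x (inord 2) (inord 2) + sample_cov x (inord 3) (inord 3).
  by rewrite !sample_covE -meanD; apply: eq_mean => n; rewrite -!expr2.
have -> : Rcbar c x = sample_cov x (inord 0) (inord 2)
    - twist c * sample_cov x (inord 1) (inord 3).
  rewrite !sample_covE -meanZ -meanB; apply: eq_mean => n.
  by case: (c); rewrite /twist /I1 /I2 /Q1 /Q2; ring.
have -> : Rsbar c x = sample_cov x (inord 0) (inord 3)
    + twist c * sample_cov x (inord 1) (inord 2).
  rewrite !sample_covE -meanZ -meanD; apply: eq_mean => n.
  by case: (c); rewrite /twist /I1 /I2 /Q1 /Q2; ring.
rewrite !sum4; case: c => /=;
  rewrite /twist ![(_ - sample_cov x) _ _]mxE ![(- sample_cov x) _ _]mxE !mx44E //=;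
  rewrite (symm (inord 1) (inord 0)) (symm (inord 2) (inord 0))
    (symm (inord 2) (inord 1)) (symm (inord 3) (inord 0))
    (symm (inord 3) (inord 1)) (symm (inord 3) (inord 2)); by field.
Qed.

(** A feasible closed-form point annihilates all four squares, so the minimum is [K] and every
    minimizer annihilates them too. *)
Lemma mfn_closed_form c x : closed_form_defined c x ->
  mfn_estimators c x = closed_form c x.
Proof.
move=> cfd; have [K KE] := frobenius_sqr c x.
have normE th th' : (frobenius_norm (Sigma c th - sample_cov x)
    <= frobenius_norm (Sigma c th' - sample_cov x)) =
    (\sum_i \sum_j (Sigma c th - sample_cov x) i j ^+ 2 <=
     \sum_i \sum_j (Sigma c th' - sample_cov x) i j ^+ 2).
  by rewrite /frobenius_norm ler_sqrt // sumr_ge0 // => i _; rewrite sumr_ge0 // => j _; rewrite sqr_ge0.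
have [th0 /(closed_formP _ cfd)[f0 [e1 e2 e3 e4]]] := closed_form_nonempty c x.
apply/seteqP; split=> th.
  move=> [f /(_ _ f0)]; rewrite normE !KE e1 e2 e3 e4 !subrr expr0n /= !mulr0 !addr0.
  set A := sigma1 th ^+ 2 - _; set B := sigma2 th ^+ 2 - _.
  set C := cross th * cos _ - _; set D := cross th * sin _ - _ => le0.
  have [A0 B0 C0 D0] : [/\ A ^+ 2 = 0, B ^+ 2 = 0, C ^+ 2 = 0 & D ^+ 2 = 0].
    have := sqr_ge0 A; have := sqr_ge0 B; have := sqr_ge0 C; have := sqr_ge0 D.
    by split; lra.
  apply/(closed_formP _ cfd); split=> //.
  by split; apply/eqP; rewrite -subr_eq0 -sqrf_eq0; apply/eqP.
move=> /(closed_formP _ cfd)[f [g1 g2 g3 g4]]; split=> // th' _.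
rewrite normE !KE g1 g2 g3 g4 !subrr expr0n /= !mulr0 !addr0 -!addrA lerDl.
by rewrite !addr_ge0 // mulr_ge0 // sqr_ge0.
Qed.

(** * Gaussian likelihood and Stein's loss *)

Lemma gram_det_gt0 c th : feasible th -> Sigma c th \in unitmx ->
  [/\ 0 < sigma1 th ^+ 2, 0 < sigma2 th ^+ 2 & 0 < gram_det th].
Proof.
move=> [s10 s20 r0 r1]; rewrite SigmaE block44_unit -/(gram_det th) => D0.
(* Invertibility excludes a zero factor here, and feasibility fixes the signs. *)
have E : gram_det th = (sigma1 th ^+ 2 * sigma2 th ^+ 2) * (1 - rho th ^+ 2).
  by rewrite /gram_det /cross; ring.
have nz (u v : R) : u * v != 0 -> u != 0 /\ v != 0.
  by rewrite mulf_eq0 negb_or => /andP.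
move: D0; rewrite E => /nz[/nz[a0 b0] d0].
have [a1 b1] : 0 < sigma1 th ^+ 2 /\ 0 < sigma2 th ^+ 2.
  by rewrite !lt_def a0 b0 !sqr_ge0.
split=> //; apply: mulr_gt0; first exact: mulr_gt0.
by rewrite lt_def d0 subr_ge0 expr_le1.
Qed.

(** The 4 x 4 determinant is the square of [gram_det], and inversion swaps the two variances and
    negates [cross], so the data enter only through the four sample means. *)
Lemma log_likelihood_Sigma c x th : (0 < N)%N ->
  feasible th -> Sigma c th \in unitmx ->
  log_likelihood x (Sigma c th) = - (N%:R / 2) *
    (2 * ln (gram_det th) + 4 * ln (2 * pi)
     + (sigma2 th ^+ 2 * P1bar x + sigma1 th ^+ 2 * P2bar x
        - 2 * (cross th * cos (phi th)) * Rcbar c x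
        - 2 * (cross th * sin (phi th)) * Rsbar c x) / gram_det th).
Proof.
move=> N0 f u; have [a0 b0 D0] := gram_det_gt0 f u.
have Dn0 : gram_det th != 0 by rewrite gt_eqF.
rewrite /log_likelihood; congr (_ * (_ + _ + _)).
  by rewrite SigmaE det_block44 ?gt_eqF // -/(gram_det th) lnXn // mulr_natl.
transitivity (mean (fun n => (gram_det th)^-1 *
  (sigma2 th ^+ 2 * (I1 (x n) ^+ 2 + Q1 (x n) ^+ 2)
   + sigma1 th ^+ 2 * (I2 (x n) ^+ 2 + Q2 (x n) ^+ 2)
   - (2 * (cross th * cos (phi th)) * rc c (x n)
      + 2 * (cross th * sin (phi th)) * rs c (x n))))).
  apply: eq_mean => n; rewrite SigmaE invmx_block44 // -/(gram_det th).
  rewrite -scalemxAr -scalemxAl mxE; congr (_ * _).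
  by rewrite quad_block44; ring.
rewrite meanZ meanB 2!meanD 4!meanZ mulrC opprD addrA.
by rewrite -/(P1bar x) -/(P2bar x) -/(Rcbar c x) -/(Rsbar c x).
Qed.

Lemma ln_lt_subr1 (t : R) : 0 < t -> t != 1 -> ln t < t - 1.
Proof.
move=> t0 t1; rewrite ltrBrDl.
have := @expR_gt1Dx _ (ln t); rewrite lnK //; apply.
by rewrite ln_eq0.
Qed.

(* With w = u / a, completing the square in b = (D + |u|^2) / a turns the
   normalized trace of H^-1 H', for H = [[a, u], [u^*, b]] Hermitian positive
   definite, into y + z + a a' |w - w'|^2 / D with y = a' / a, z = D' a / (D a')
   and y z = D' / D. *)
Lemma stein_loss_ge0 (a b uc us a' b' uc' us' : R)
    (D := a * b - (uc ^+ 2 + us ^+ 2)) (D' := a' * b' - (uc' ^+ 2 + us' ^+ 2))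
    (L := (b * a' + a * b' - 2 * uc * uc' - 2 * us * us') / D) :
  0 < a -> 0 < a' -> 0 < D -> 0 < D' ->
  2 + ln D' <= L + ln D ?= iff [&& a == a', b == b', uc == uc' & us == us'].
Proof.
move=> a0 a'0 D0 D'0.
have [an a'n Dn] : [/\ a != 0, a' != 0 & D != 0] by rewrite !gt_eqF.
pose y := a' / a; pose z := D' * a / (D * a').
pose e := (uc / a - uc' / a') ^+ 2 + (us / a - us' / a') ^+ 2.
have y0 : 0 < y by rewrite divr_gt0.
have z0 : 0 < z by rewrite divr_gt0 // mulr_gt0.
have LE : L = y + z + a * a' * e / D.
  rewrite /L /y /z /e; apply: (mulIf Dn); rewrite mulfVK //.
  transitivity (a' / a * D + D' * a / a' + a * a' * ((uc / a - uc' / a') ^+ 2 + (us / a - us' / a') ^+ 2)).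
    by rewrite /D /D'; field; rewrite ?an ?a'n.
  by field; rewrite ?an ?a'n ?Dn.
have lnE : ln D' - ln D = ln y + ln z.
  rewrite -lnM ?posrE // -ln_div ?posrE //; congr ln.
  by rewrite /y /z; field; rewrite ?an ?a'n ?Dn.
have e0 : 0 <= a * a' * e / D.
  by rewrite divr_ge0 ?(ltW D0) // mulr_ge0 ?addr_ge0 ?sqr_ge0 // mulr_ge0 ?(ltW a0) ?(ltW a'0).
have ln_le (t : R) : 0 < t -> ln t <= t - 1.
  by move=> t0; have [->|t1] := eqVneq t 1; [rewrite ln1 subrr | apply/ltW; exact: ln_lt_subr1].
have := ln_le _ y0; have := ln_le _ z0 => lz ly.
split; first by move: lnE; rewrite LE; lra.
apply/eqP/and4P => [E|[/eqP ea /eqP eb /eqP ec /eqP es]]; last first.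
  have -> : D' = D by rewrite /D /D' ea eb ec es.
  by congr (_ + _); apply: (mulIf Dn); rewrite mulfVK // /D ea eb ec es; ring.
(* Equality makes each of y - 1 - ln y, z - 1 - ln z and the [e] term vanish. They give in turn a =
   a', D = D' and u = u', and then b = b'. *)
have y1 : y = 1.
  by apply/eqP; apply: contraT => y1; have := ln_lt_subr1 y0 y1; move: lnE E; rewrite LE; lra.
have z1 : z = 1.
  by apply/eqP; apply: contraT => z1; have := ln_lt_subr1 z0 z1; move: lnE E; rewrite LE; lra.
have ee : a * a' * e / D = 0.
  by move: lnE E; rewrite LE y1 z1 ln1; lra.
have aE : a = a' by move: y1; rewrite /y => /divr1_eq.
have DE : D = D'.
  by move: z1; rewrite /z -aE -mulf_div divff // mulr1 => /divr1_eq.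
move/eqP: ee; rewrite !mulf_eq0 invr_eq0 (negbTE an) (negbTE a'n) (negbTE Dn) orbF /=.
rewrite /e -aE paddr_eq0 ?sqr_ge0 // !sqrf_eq0 -!mulrBl !mulf_eq0 invr_eq0 (negbTE an) !orbF !subr_eq0.
move=> /andP[/eqP ec /eqP es]; split; apply/eqP => //.
by apply: (mulfI an); move: DE; rewrite /D /D' -aE ec es; lra.
Qed.

(** The bound [rho_hat c x < 1] makes the closed-form covariance invertible, hence a legitimate
    competitor; Stein's loss relative to it gives optimality and uniqueness. *)
Lemma ml_closed_form c x : (0 < N)%N -> closed_form_defined c x ->
  rho_hat c x < 1 -> ml_estimators c x = closed_form c x.
Proof.
move=> N0 cfd r1; have [P10 P20 R0] := cfd.
have [th0 cf0] := closed_form_nonempty c x.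
have [f0 [e1 e2 e3 e4]] := (closed_formP _ cfd).1 cf0.
have N2 : 0 < N%:R / 2 :> R by rewrite divr_gt0 // ltr0n.
have unit_cf th : closed_form c x th -> Sigma c th \in unitmx.
  move=> cf; have [f [g1 g2 _ _]] := (closed_formP _ cfd).1 cf.
  have [_ _ rE _] := cf; have [_ _ rr _] := f.
  rewrite SigmaE block44_unit.
  have -> : sigma1 th ^+ 2 * sigma2 th ^+ 2 - cross th ^+ 2 =
    (P1bar x / 2) * (P2bar x / 2) * (1 - rho th ^+ 2) by rewrite -g1 -g2 /cross; ring.
  apply: mulf_neq0; first by rewrite mulf_neq0 // mulf_neq0 // invr_eq0 pnatr_eq0.
  rewrite subr_eq0 eq_sym lt_eqF //.
  by rewrite rE expr_lt1 // -rE.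
have u0 := unit_cf _ cf0.
have gE th : gram_det th = sigma1 th ^+ 2 * sigma2 th ^+ 2 -
   ((cross th * cos (phi th)) ^+ 2 + (cross th * sin (phi th)) ^+ 2).
  rewrite /gram_det -[cross th ^+ 2]mulr1 -(cos2Dsin2 (phi th)); ring.
have key th : feasible th -> Sigma c th \in unitmx ->
  log_likelihood x (Sigma c th) <= log_likelihood x (Sigma c th0) ?= iff
  [&& sigma1 th ^+ 2 == sigma1 th0 ^+ 2, sigma2 th ^+ 2 == sigma2 th0 ^+ 2,
      cross th * cos (phi th) == cross th0 * cos (phi th0) &
      cross th * sin (phi th) == cross th0 * sin (phi th0)].
  move=> f u; have [a0 b0 D0] := gram_det_gt0 f u.
  have [a0' b0' D0'] := gram_det_gt0 f0 u0.
  rewrite !log_likelihood_Sigma //.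
  (* Replacing the sample means by the moments of [th0] turns the data term into twice the trace
     term of Stein's loss. *)
  have -> : P1bar x = 2 * sigma1 th0 ^+ 2 by rewrite e1; field.
  have -> : P2bar x = 2 * sigma2 th0 ^+ 2 by rewrite e2; field.
  have -> : Rcbar c x = 2 * (cross th0 * cos (phi th0)) by rewrite e3; field.
  have -> : Rsbar c x = 2 * (cross th0 * sin (phi th0)) by rewrite e4; field.
  have D0n : gram_det th0 != 0 by rewrite gt_eqF.
  have L0 : sigma2 th0 ^+ 2 * (2 * sigma1 th0 ^+ 2) + sigma1 th0 ^+ 2 * (2 * sigma2 th0 ^+ 2)
    - 2 * (cross th0 * cos (phi th0)) * (2 * (cross th0 * cos (phi th0)))
    - 2 * (cross th0 * sin (phi th0)) * (2 * (cross th0 * sin (phi th0))) = 4 * gram_det th0.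
    by rewrite gE; ring.
  rewrite L0 mulfK //.
  have := @stein_loss_ge0 (sigma1 th ^+ 2) (sigma2 th ^+ 2)
    (cross th * cos (phi th)) (cross th * sin (phi th))
    (sigma1 th0 ^+ 2) (sigma2 th0 ^+ 2)
    (cross th0 * cos (phi th0)) (cross th0 * sin (phi th0)).
  rewrite -!gE => /(_ a0 a0' D0 D0') [le eq].
  split.
    rewrite ler_nM2l ?oppr_lt0 //; move: le; rewrite -!addrA; lra.
  rewrite -eq; apply/eqP/eqP.
    move/mulfI; rewrite oppr_eq0 gt_eqF // => /(_ isT); lra.
  move=> E; congr (_ * _); move: E; lra.
apply/seteqP; split=> th.
  move=> [f u /(_ _ f0 u0)]; rewrite (ge_leif (key _ f u)).
  move=> /and4P[/eqP h1 /eqP h2 /eqP h3 /eqP h4].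
  by apply/(closed_formP _ cfd); split=> //; split; rewrite ?h1 ?h2 ?h3 ?h4.
move=> cf; have [f [g1 g2 g3 g4]] := (closed_formP _ cfd).1 cf.
split=> //; first exact: unit_cf.
move=> th' f' u'; apply: le_trans (key _ f' u').1 _.
have := (key _ f (unit_cf _ cf)).2.
by rewrite g1 g2 g3 g4 e1 e2 e3 e4 !eqxx => /eqP ->.
Qed.

End estimators.

(** * Zeros of polynomials are null sets *)

Section polynomial_functions.
Context {R : realType}.
Implicit Types f g : R -> R.

Definition polynomial_fun f := exists p : {poly R}, forall x, f x = p.[x].

Lemma polynomial_cst a : polynomial_fun (fun=> a).
Proof. by exists a%:P => x; rewrite hornerC. Qed.

Lemma polynomial_add f g : polynomial_fun f -> polynomial_fun g ->
  polynomial_fun (fun x => f x + g x).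
Proof. by move=> [p fp] [q gq]; exists (p + q) => x; rewrite hornerD fp gq. Qed.

Lemma polynomial_mul f g : polynomial_fun f -> polynomial_fun g ->
  polynomial_fun (fun x => f x * g x).
Proof. by move=> [p fp] [q gq]; exists (p * q) => x; rewrite hornerM fp gq. Qed.

Lemma polynomial_opp f : polynomial_fun f -> polynomial_fun (fun x => - f x).
Proof. by move=> [p fp]; exists (- p) => x; rewrite hornerN fp. Qed.

(** The roots form a finite set, by induction on the size of [p]; finite sets are Lebesgue null, and
    Lebesgue measure dominates the normal law. *)
Lemma normal_prob_roots (p : {poly R}) : p != 0 ->
  normal_prob 0 1 [set x : R | p.[x] = 0] = 0%E.
Proof.
move=> p0; suff [s sP] : exists s : seq R, [set x | p.[x] = 0] `<=` [set` s].
  have cp : countable [set x : R | p.[x] = 0].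
    apply: (sub_countable (subset_card_le sP)).
    exact/finite_set_countable/finite_seq.
  have mp : measurable [set x : R | p.[x] = 0].
    by apply: countable_measurable => // t; exact: measurable_set1.
  have /null_content_dominatesP dom := normal_prob_dominates (0 : R) 1.
  by apply: dom => //; exact: countable_lebesgue_measure0.
have [n] := ubnP (size p); elim: n p p0 => // n IH p p0 sn.
have [[x px]|np] := pselect (exists x, root p x); last first.
  by exists [::] => x /= /eqP px; case: np; exists x.
have /factor_theorem[q pq] := px.
have q0 : q != 0 by apply: contraNneq p0 => q0; rewrite pq q0 mul0r.
have [|s sP] := IH q q0.
  by move: sn; rewrite pq size_Mmonic ?monicXsubC // size_XsubC addn2 ltnS.
exists (x :: s) => y /=; rewrite pq hornerM !hornerE => /eqP.
rewrite mulf_eq0 subr_eq0 in_cons => /orP[/eqP qy|->//].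
by rewrite (sP y) ?orbT.
Qed.

End polynomial_functions.

(** * Null sets of product measures *)

Section null_sets.
Context {R : realType}.

(** The product measure of [D] is the integral of the measures of its sections, which vanish outside
    the null set [M]. *)
Lemma product_prob_null d1 d2 (T1 : measurableType d1) (T2 : measurableType d2)
    (m1 : probability T1 R) (m2 : probability T2 R) (D : set (T1 * T2))
    (M : set T1) :
  measurable D -> measurable M -> m1 M = 0%E ->
  (forall t, ~ M t -> m2 (xsection D t) = 0%E) -> (m1 \x m2)%E D = 0%E.
Proof.
move=> mD mM M0 D0; rewrite /product_measure1.
rewrite (@ae_eq_integral _ _ _ m1 setT (cst 0%E)) ?integral0 //.
  exact: measurable_fun_xsection.
exists M; split => // t /= h; apply: contrapT => Mt; apply: h => _.
exact: D0.
Qed.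

(** An implication, so that it can be required of all slices of a function, including slices that
    vanish identically. *)
Definition ae_nonzero d (T : measurableType d) (mu : set T -> \bar R)
    (f : T -> R) :=
  (exists t, f t != 0) -> mu [set t | f t = 0] = 0%E.

Lemma measurable_zeros d (T : measurableType d) (f : T -> R) :
  measurable_fun setT f -> measurable [set t | f t = 0].
Proof.
move=> mf; rewrite -[X in measurable X]setTI.
exact: (mf measurableT [set 0] (measurable_set1 0)).
Qed.

Lemma ae_nonzero_polynomial f : polynomial_fun f ->
  ae_nonzero (normal_prob (0 : R) 1) f.
Proof.
move=> [p fp] [x fx].
have -> : [set t | f t = 0] = [set t | p.[t] = 0].
  by apply/seteqP; split => t /=; rewrite fp.
by apply: normal_prob_roots; apply: contraNneq fx => p0; rewrite fp p0 horner0.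
Qed.

(* Fubini: off the null set of t with f(t, x0) = 0, the nonzero polynomial
   f(t, _) has finitely many roots. *)
Lemma ae_nonzero_product d (T : measurableType d) (mu : probability T R)
    (f : T * R -> R) :
  measurable_fun setT f ->
  (forall t, polynomial_fun (fun x => f (t, x))) ->
  (forall x, ae_nonzero mu (fun t => f (t, x))) ->
  ae_nonzero (mu \x normal_prob (0 : R) 1)%E f.
Proof.
move=> mf fp fmu [[t0 x0] f0].
apply: (@product_prob_null _ _ _ _ mu (normal_prob (0 : R) 1) _ [set t | f (t, x0) = 0]).
- exact: measurable_zeros.
- by apply: measurable_zeros; exact: measurableT_comp.
- by apply: fmu; exists t0.
move=> t ft; have := ae_nonzero_polynomial (fp t).
have -> : xsection [set tx | f tx = 0] t = [set x | f (t, x) = 0].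
  by apply/seteqP; split => x /=; rewrite /xsection /= inE.
by apply; exists x0; apply/eqP.
Qed.

End null_sets.

(** * Gaussian vectors and independence *)

Section gaussian_vectors.
Context {R : realType}.
Implicit Types (h : 'cV[R]_4 -> R) (u v : 'cV[R]_4).

(** A property stable under linear substitution; restricted to coordinate lines it feeds the
    iterated Fubini argument. *)
Definition line_polynomial h :=
  forall u v, polynomial_fun (fun t => h (u + t *: v)).

Definition col4 (z : R * R * R * R) : 'cV[R]_4 :=
  col_of_tuple [tuple z.1.1.1; z.1.1.2; z.1.2; z.2].

Lemma line_polynomial_entry i j : line_polynomial (fun v => v i j).
Proof.
move=> u v; exists ((u i j)%:P + 'X * (v i j)%:P) => t.
by rewrite !hornerE !mxE.
Qed.

Lemma measurable_entry (A : 'M[R]_4) i :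
  measurable_fun [set: R * R * R * R] (fun z => (A *m col4 z) i 0).
Proof.
under eq_fun do rewrite mxE.
apply: measurable_sum => j; apply: measurable_funM; first exact: measurable_cst.
under eq_fun do rewrite mxE.
have m1 := @measurable_fst _ _ (R * R * R)%type R.
have m2 := @measurable_snd _ _ (R * R * R)%type R.
have n1 := @measurable_fst _ _ (R * R)%type R.
have n2 := @measurable_snd _ _ (R * R)%type R.
move: j; apply: ord4P; rewrite /tnth /= inordK //=.
- apply: (measurableT_comp measurable_fst); exact: (measurableT_comp n1 m1).
- apply: (measurableT_comp measurable_snd); exact: (measurableT_comp n1 m1).
- exact: (measurableT_comp n2 m1).
Qed.

(** The coordinates are peeled off one at a time, from the last to the first. *)
Lemma std_normal4_zeros (f : R * R * R * R -> R) :
  measurable_fun setT f ->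
  (forall z : R * R * R * R, polynomial_fun (fun t => f (z.1.1.1, z.1.1.2, z.1.2, t))) ->
  (forall z : R * R * R * R, polynomial_fun (fun t => f (z.1.1.1, z.1.1.2, t, z.2))) ->
  (forall z : R * R * R * R, polynomial_fun (fun t => f (z.1.1.1, t, z.1.2, z.2))) ->
  (forall z : R * R * R * R, polynomial_fun (fun t => f (t, z.1.1.2, z.1.2, z.2))) ->
  ae_nonzero std_normal4 f.
Proof.
move=> mf p4 p3 p2 p1.
pose n1 : probability _ R := normal_prob (0 : R) 1.
pose n2 : probability _ R := (n1 \x n1)%E.
pose n3 : probability _ R := (n2 \x n1)%E.
apply: (@ae_nonzero_product _ _ _ n3) => //.
  (* The 0 fills the coordinate that [p4] does not read; likewise below. *)
  by move=> [[a b] c]; exact: (p4 (a, b, c, 0)).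
move=> d; apply: (@ae_nonzero_product _ _ _ n2).
- exact: (measurable_fun_pair1 d mf).
- by move=> [a b]; exact: (p3 (a, b, 0, d)).
move=> c; apply: (@ae_nonzero_product _ _ _ n1).
- exact: (measurable_fun_pair1 c (measurable_fun_pair1 d mf)).
- by move=> a; exact: (p2 (a, 0, c, d)).
by move=> b; apply: ae_nonzero_polynomial; exact: (p1 (0, b, c, d)).
Qed.

(** In law [X] is A Z, and h(A z) is polynomial in each coordinate of z. It is nonzero at z = A^T u
    because A A^T = S. *)
Lemma gaussian_zeros d (T : measurableType d) (P : probability T R)
    (X : {RV P >-> 4.-tuple R}) (S : 'M[R]_4) h :
  centered_gaussian X S -> line_polynomial h ->
  measurable_fun setT (fun t : 4.-tuple R => h (col_of_tuple t)) ->
  (exists u, h (S *m u) != 0) ->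
  P [set w | h (col_of_tuple (X w)) = 0] = 0%E.
Proof.
move=> [A AS law] hp mh [u hu].
rewrite -[LHS]/(distribution P X [set t | h (col_of_tuple t) = 0]).
rewrite law; last exact: measurable_zeros.
pose f z := h (A *m col4 z).
have fE z : f z = h (col_of_tuple [tuple (A *m col4 z) i 0 | i < 4]).
  by congr h; apply/colP => i; rewrite [RHS]mxE tnth_mktuple.
have -> : [set z | [set t | h (col_of_tuple t) = 0]
     [tuple (A *m col_of_tuple [tuple z.1.1.1; z.1.1.2; z.1.2; z.2]) i 0 | i < 4]]
   = [set z | f z = 0].
  by apply/seteqP; split => z /=; rewrite fE.
have line (g : R -> R * R * R * R) (z : R * R * R * R) e :
    (forall t, col4 (g t) = col4 z + t *: e) -> polynomial_fun (fun t => f (g t)).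
  move=> gE; have [p pE] := hp (A *m col4 z) (A *m e).
  by exists p => t; rewrite -pE /f gE mulmxDr scalemxAr.
apply: std_normal4_zeros.
- rewrite (_ : f = (fun t => h (col_of_tuple t)) \o
      (fun z => [tuple (A *m col4 z) i 0 | i < 4])); last first.
    by apply/funext => z /=; rewrite fE.
  apply: measurableT_comp => //; apply/measurable_fun_tnthP => i.
  rewrite (_ : _ \o _ = fun z => (A *m col4 z) i 0); first exact: measurable_entry.
  by apply/funext => z; rewrite /= tnth_mktuple.
- move=> z; apply: (line _ (z.1.1.1, z.1.1.2, z.1.2, 0) (col4 (0, 0, 0, 1))) => t.
  apply/colP; apply: ord4P; rewrite !mxE /tnth /= !inordK //=; ring.
- move=> z; apply: (line _ (z.1.1.1, z.1.1.2, 0, z.2) (col4 (0, 0, 1, 0))) => t.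
  apply/colP; apply: ord4P; rewrite !mxE /tnth /= !inordK //=; ring.
- move=> z; apply: (line _ (z.1.1.1, 0, z.1.2, z.2) (col4 (0, 1, 0, 0))) => t.
  apply/colP; apply: ord4P; rewrite !mxE /tnth /= !inordK //=; ring.
- move=> z; apply: (line _ (0, z.1.1.2, z.1.2, z.2) (col4 (1, 0, 0, 0))) => t.
  apply/colP; apply: ord4P; rewrite !mxE /tnth /= !inordK //=; ring.
pose w := A^T *m u.
exists (w (inord 0) 0, w (inord 1) 0, w (inord 2) 0, w (inord 3) 0).
rewrite /f (_ : col4 _ = w) /w ?mulmxA ?AS //.
by apply/colP; apply: ord4P; rewrite mxE /tnth /= inordK.
Qed.

End gaussian_vectors.

(** * Independence *)

Section independence.
Context {R : realType} {d : measure_display} {T : measurableType d}.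
Variable P : probability T R.

(** By uniqueness of product measures the joint law of [U] and [V] is the product of their laws, so
    sections can be tested one by one. *)
Lemma indep_null d1 d2 (T1 : measurableType d1) (T2 : measurableType d2)
    (U : {mfun T >-> T1}) (V : {mfun T >-> T2}) (D : set (T1 * T2))
    (M : set T1) :
  (forall A B, measurable A -> measurable B ->
    P (U @^-1` A `&` V @^-1` B) = (P (U @^-1` A) * P (V @^-1` B))%E) ->
  measurable D -> measurable M -> P (U @^-1` M) = 0%E ->
  (forall t, ~ M t -> P [set w | D (t, V w)] = 0%E) ->
  P [set w | D (U w, V w)] = 0%E.
Proof.
move=> UV mD mM M0 D0.
have mUV : measurable_fun setT (fun w => (U w, V w)).
  by apply: measurable_fun_pair; exact: measurable_funPT.
pose mUVf : {mfun T >-> (T1 * T2)%type} := HB.pack (fun w => (U w, V w)) (isMeasurableFun.Build _ _ _ _ _ mUV).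
rewrite -[LHS]/(distribution P mUVf D).
rewrite -(@product_measure_unique _ _ _ _ _ (distribution P U) (distribution P V)) //.
apply: (product_prob_null mD mM) => // t Mt.
rewrite -(D0 t Mt) -[LHS]/(P (V @^-1` xsection D t)); congr (P _).
by apply/seteqP; split=> w /=; rewrite /xsection /= inE.
Qed.

End independence.

Section independent_samples.
Context {R : realType} {d : measure_display} {T : measurableType d}.
Context {P : probability T R} {N : nat}.
Variable X : 'I_N -> {RV P >-> 4.-tuple R}.
Hypothesis indepX : independent_samples X.

Lemma indep_pair i j A B : i != j -> measurable A -> measurable B ->
  P (X i @^-1` A `&` X j @^-1` B) = (P (X i @^-1` A) * P (X j @^-1` B))%E.
Proof.
move=> ij mA mB.
pose C n := if n == i then A else if n == j then B else setT.
have ji : j == i = false by rewrite eq_sym (negbTE ij).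
have mC n : measurable (C n) by rewrite /C; case: ifP => // _; case: ifP.
have -> : X i @^-1` A `&` X j @^-1` B = [set w | forall n, C n (X n w)].
  apply/seteqP; split => w /= => [[Aw Bw] n|H].
    by rewrite /C; case: eqP => [->//|_]; case: eqP => [->//|_].
  by split; [have := H i|have := H j]; rewrite /C ?ji eqxx.
rewrite indepX // (bigD1 i) //= (bigD1 j) /=; last by rewrite eq_sym.
rewrite big1 ?mule1 => [|n /andP[/negbTE ni /negbTE nj]].
  by rewrite /C eqxx ji eqxx.
by rewrite /C ni nj preimage_setT probability_setT.
Qed.

(** Pi-system argument: the cylinders [G] leave sample [i0] free, and on them the finite measures
    P(E and X i0 in B) and P(X i0 in B) P(E) agree. They then agree on the generated sigma-algebra,
    which contains the event of the sum. *)
Lemma indep_sum i0 (g : 4.-tuple R -> R) A B : measurable_fun setT g ->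
  measurable A -> measurable B ->
  P ([set w | A (\sum_(n | n != i0) g (X n w))] `&` X i0 @^-1` B)
  = (P [set w | A (\sum_(n | n != i0) g (X n w))%R] * P (X i0 @^-1` B))%E.
Proof.
move=> mg mA mB.
pose G : set (set T) := [set E | exists C : 'I_N -> set (4.-tuple R),
  [/\ forall n, measurable (C n), C i0 = setT & E = [set w | forall n, C n (X n w)]]].
have mG : G `<=` measurable.
  move=> _ [C [mC _ ->]].
  have -> : [set w | forall n, C n (X n w)] = \bigcap_(n in setT) (X n @^-1` C n).
    by apply/seteqP; split => w /= H n; [move=> _|]; apply: H.
  apply: fin_bigcap_measurable => // n _.
  by rewrite -[X in measurable X]setTI; exact: measurable_funP.
have GI : setI_closed G.
  move=> _ _ [C [mC C0 ->]] [D [mD D0 ->]]; exists (fun n => C n `&` D n); split.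
  - by move=> n; exact: measurableI.
  - by rewrite C0 D0 setIT.
  - apply/seteqP; split => w /= => [[HC HD] n|H]; first by split.
    by split => n; have [] := H n.
have mE : measurable (X i0 @^-1` B).
  by rewrite -[X in measurable X]setTI; exact: measurable_funP.
pose pE : {nonneg R} := NngNum (fine_ge0 (measure_ge0 P (X i0 @^-1` B))).
have pEE : (pE%:num)%:E = P (X i0 @^-1` B) by rewrite /= fineK // fin_num_measure.
pose m1 : {measure set T -> \bar R} := mrestr P mE.
pose m2 : {measure set T -> \bar R} := mscale pE P.
have GT : G setT.
  by exists (fun=> setT); split => //; apply/seteqP; split.
suff sG : <<s G >> [set w | A (\sum_(n | n != i0) g (X n w))].
  set W := [set w | _]; suff E0 : m1 W = m2 W.
    by rewrite -[LHS]/(m1 W) E0 -[LHS]/((pE%:num)%:E * P W)%E pEE muleC.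
  apply: (@g_sigma_algebra_measure_unique _ _ _ G mG (fun=> setT)) => //.
  - by rewrite bigcup_const //; exists 0%N.
  - move=> _ [C [mC C0 ->]]; rewrite -[RHS]/((pE%:num)%:E * P _)%E pEE.
    rewrite -[LHS]/(P (_ `&` _)).
    pose D n := if n == i0 then B else C n.
    have -> : [set w | forall n, C n (X n w)] `&` X i0 @^-1` B =
        [set w | forall n, D n (X n w)].
      apply/seteqP; split => w /= => [[HC HB] n|H].
        by rewrite /D; case: eqP => [->|_].
      split => [n|]; last by have := H i0; rewrite /D eqxx.
      by have := H n; rewrite /D; case: eqP => [->|//]; rewrite C0.
    rewrite !indepX //; last by move=> n; rewrite /D; case: ifP.
    rewrite (bigD1 i0) //= [in RHS](bigD1 i0) //= C0 preimage_setT probability_setT mul1e.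
    by rewrite /D eqxx; congr (_ * _)%E; apply: eq_bigr => n /negbTE ->.
  - by move=> _; rewrite -ge0_fin_numE ?fin_num_measure ?setTI.
(* With this domain type, measurability of [f] refers to the sigma-algebra generated by [G]. *)
pose f (w : g_sigma_algebraType G) := \sum_(n | n != i0) g (X n w).
have mf : measurable_fun setT f.
  rewrite /f; under eq_fun do rewrite big_mkcond /=.
  apply: measurable_sum => n; case: (eqVneq n i0) => [_|ni] /=; first exact: measurable_cst.
  move=> _ Y mY; rewrite setTI; apply: sub_sigma_algebra.
  exists (fun m => if m == n then g @^-1` Y else setT); split.
  - move=> m; case: ifP => // _; rewrite -[X in measurable X]setTI; exact: mg.
  - by rewrite eq_sym (negbTE ni).
  - apply/seteqP; split => w /= => [Yw m|/(_ n)]; last by rewrite eqxx.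
    by case: eqP => [->|].
by have := mf measurableT _ mA; rewrite setTI.
Qed.

End independent_samples.

(** * Almost sure statements *)

Section generic_samples.
Context {R : realType}.
Implicit Types (c : radar) (th : params R) (u v w : 'cV[R]_4).

(* Vanishing of the 2 x 2 minors of the pairs (conj(z1), z2) is the equality
   case of Cauchy-Schwarz; this is the real part of one minor. *)
Definition minor_re c v w : R :=
  I2 v * I1 w + twist c * Q2 v * Q1 w - (I2 w * I1 v + twist c * Q2 w * Q1 v).

(** If [rho_hat] were at least 1, Cauchy-Schwarz would be an equality and all residuals would
    vanish; the pairs (conj(z1), z2) would be proportional and the minor 0. *)
Lemma rho_hat_lt1 N c (x : 'I_N -> 'cV[R]_4) i j :
  (0 < N)%N -> P1bar x != 0 -> P2bar x != 0 ->
  minor_re c (x i) (x j) != 0 -> rho_hat c x < 1.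
Proof.
move=> N0 P10 P20; apply: contraNT; rewrite -leNgt => r1.
have p1 : 0 < P1bar x by rewrite lt_def P10 P1bar_ge0.
have p12 : 0 < P1bar x * P2bar x by rewrite mulr_gt0 // lt_def P20 P2bar_ge0.
have E : Rcbar c x ^+ 2 + Rsbar c x ^+ 2 = P1bar x * P2bar x.
  apply/eqP; rewrite eq_le Rbar_le_Pbar //=.
  have : 1 <= rho_hat c x ^+ 2 by rewrite exprn_ege1.
  rewrite sqr_sqrtr ?divr_ge0 ?addr_ge0 ?sqr_ge0 ?(ltW p12) //.
  by rewrite ler_pdivlMr // mul1r.
have res n : residual_re c (P1bar x) (Rcbar c x) (Rsbar c x) (x n) = 0 /\
             residual_im c (P1bar x) (Rcbar c x) (Rsbar c x) (x n) = 0.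
  have /= := mean_residual c x; rewrite E subrr mulr0.
  move/(mean_eq0 N0) => H; have /eqP := H (fun n => addr_ge0 (sqr_ge0 _) (sqr_ge0 _)) n.
  by rewrite paddr_eq0 ?sqr_ge0 // !sqrf_eq0 => /andP[/eqP -> /eqP ->].
apply/eqP/(mulfI P10); rewrite mulr0 /minor_re.
have [ei fi] := res i; have [ej fj] := res j.
move: ei fi ej fj => /eqP + /eqP + /eqP + /eqP.
rewrite !subr_eq0 => /eqP ei /eqP fi /eqP ej /eqP fj.
transitivity (P1bar x * I2 (x i) * I1 (x j) + twist c * (P1bar x * Q2 (x i)) * Q1 (x j)
   - (P1bar x * I2 (x j) * I1 (x i) + twist c * (P1bar x * Q2 (x j)) * Q1 (x i))).
  by ring.
by rewrite ei fi ej fj; ring.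
Qed.

Lemma line_polynomial_cst a : line_polynomial (fun=> a : R).
Proof. by move=> u v; exact: polynomial_cst. Qed.

Lemma line_polynomial_add (f g : 'cV[R]_4 -> R) :
  line_polynomial f -> line_polynomial g ->
  line_polynomial (fun v => f v + g v).
Proof. by move=> hf hg u v; exact: polynomial_add. Qed.

Lemma line_polynomial_mul (f g : 'cV[R]_4 -> R) :
  line_polynomial f -> line_polynomial g ->
  line_polynomial (fun v => f v * g v).
Proof. by move=> hf hg u v; exact: polynomial_mul. Qed.

Lemma line_polynomial_opp (f : 'cV[R]_4 -> R) :
  line_polynomial f -> line_polynomial (fun v => - f v).
Proof. by move=> hf u v; exact: polynomial_opp. Qed.

Lemma measurable_col_entry i :
  measurable_fun setT (fun t : 4.-tuple R => col_of_tuple t i 0).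
Proof.
by under eq_fun do rewrite mxE; exact: measurable_tnth.
Qed.

(** Component of [rc] + i [rs] along e^(i t); a nonzero mean of it certifies R != 0. *)
Definition aligned c t v : R := cos t * rc c v + sin t * rs c v.

Lemma aligned_mean N c t (x : 'I_N -> 'cV[R]_4) :
  mean (fun n => aligned c t (x n)) = cos t * Rcbar c x + sin t * Rsbar c x.
Proof. by rewrite meanD !meanZ. Qed.

Lemma line_polynomial_aligned c t : line_polynomial (aligned c t).
Proof.
rewrite /aligned /rc /rs; case: c;
by repeat (apply: line_polynomial_cst || apply: line_polynomial_entry ||
  apply: line_polynomial_add || apply: line_polynomial_mul ||
  apply: line_polynomial_opp).
Qed.

Lemma measurable_aligned c t :
  measurable_fun setT (fun s : 4.-tuple R => aligned c t (col_of_tuple s)).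
Proof.
rewrite /aligned /rc /rs; case: c;
by repeat (apply: measurable_cst || apply: measurable_col_entry ||
  apply: measurable_funB || apply: measurable_funD || apply: measurable_funM).
Qed.

Lemma line_polynomial_minor c v : line_polynomial (minor_re c v).
Proof.
rewrite /minor_re;
by repeat (apply: line_polynomial_cst || apply: line_polynomial_entry ||
  apply: line_polynomial_add || apply: line_polynomial_mul ||
  apply: line_polynomial_opp).
Qed.

Lemma measurable_minor c : measurable_fun setT
  (fun s : 4.-tuple R * 4.-tuple R => minor_re c (col_of_tuple s.1) (col_of_tuple s.2)).
Proof.
have m1 i : measurable_fun setT (fun s : 4.-tuple R * 4.-tuple R => col_of_tuple s.1 i 0).
  exact: (measurableT_comp (measurable_col_entry i) measurable_fst).
have m2 i : measurable_fun setT (fun s : 4.-tuple R * 4.-tuple R => col_of_tuple s.2 i 0).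
  exact: (measurableT_comp (measurable_col_entry i) measurable_snd).
rewrite /minor_re;
by repeat (apply: measurable_cst || apply: m1 || apply: m2 ||
  apply: measurable_funB || apply: measurable_funD || apply: measurable_funM).
Qed.

Lemma col4E (a b x y : R) : [/\ I1 (col4 (a, b, x, y)) = a,
  Q1 (col4 (a, b, x, y)) = b, I2 (col4 (a, b, x, y)) = x &
  Q2 (col4 (a, b, x, y)) = y].
Proof. by split; rewrite /I1 /Q1 /I2 /Q2 mxE /tnth /= inordK. Qed.

Lemma Sigma_mulE c th (a b x y : R) (v := Sigma c th *m col4 (a, b, x, y)) :
  let C := cross th * cos (phi th) in let S := cross th * sin (phi th) in
  [/\ I1 v = sigma1 th ^+ 2 * a + (C * x + S * y),
      Q1 v = sigma1 th ^+ 2 * b + twist c * (S * x - C * y),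
      I2 v = (C * a + twist c * S * b) + sigma2 th ^+ 2 * x &
      Q2 v = (S * a - twist c * C * b) + sigma2 th ^+ 2 * y].
Proof.
have [c0 c1 c2 c3] := col4E a b x y.
rewrite /= /v SigmaE block44E /I1 /Q1 /I2 /Q2.
by split; rewrite mxE sum4 -!/(I1 _) -!/(Q1 _) -!/(I2 _) -!/(Q2 _) c0 c1 c2 c3;
  case: (c); rewrite /= !mx44E //= /twist; ring.
Qed.

End generic_samples.

(** * Almost sure nondegeneracy of the samples *)

Section almost_sure.
Context {R : realType} {d : measure_display} {T : measurableType d}.
Variable P : probability T R.
Implicit Types (c : radar) (th : params R).

Lemma ae_neq0 (f : T -> R) : measurable_fun setT f ->
  P [set w | f w = 0] = 0%E -> {ae P, forall w, f w != 0}.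
Proof.
move=> mf f0; exists [set w | f w = 0]; split => //; first exact: measurable_zeros.
by move=> w /= /negP; rewrite negbK => /eqP.
Qed.

Lemma gaussian_ae_neq0 (X : {RV P >-> 4.-tuple R}) (S : 'M[R]_4) i :
  centered_gaussian X S -> (exists u : 'cV[R]_4, (S *m u) i 0 != 0) ->
  {ae P, forall w, col_of_tuple (X w) i 0 != 0}.
Proof.
move=> gX Su; apply: ae_neq0.
  exact: (measurableT_comp (measurable_col_entry i) (measurable_funPT X)).
apply: (gaussian_zeros gX (line_polynomial_entry i 0)) => //.
exact: measurable_col_entry.
Qed.

Context {N : nat} {c : radar} {th : params R}.
Variable X : 'I_N -> {RV P >-> 4.-tuple R}.
Hypothesis indepX : independent_samples X.
Hypothesis gaussX : forall n, centered_gaussian (X n) (Sigma c th).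
Hypothesis th_feasible : feasible th.
Hypothesis s1_gt0 : 0 < sigma1 th.
Hypothesis s2_gt0 : 0 < sigma2 th.

Lemma ae_I1_neq0 n : {ae P, forall w, I1 (observation X w n) != 0}.
Proof.
apply: (gaussian_ae_neq0 (gaussX n)); exists (col4 (1, 0, 0, 0)).
have [e _ _ _] := Sigma_mulE c th 1 0 0 0.
by rewrite -/(I1 _) e !mulr0 !addr0 mulr1 expf_neq0 // gt_eqF.
Qed.

Lemma ae_I2_neq0 n : {ae P, forall w, I2 (observation X w n) != 0}.
Proof.
apply: (gaussian_ae_neq0 (gaussX n)); exists (col4 (0, 0, 1, 0)).
have [_ _ e _] := Sigma_mulE c th 0 0 1 0.
by rewrite -/(I2 _) e !mulr0 !add0r mulr1 expf_neq0 // gt_eqF.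
Qed.

(** With the other samples fixed, their sum is a constant [s], and s + aligned is a polynomial in
    sample [i0] that is nonzero somewhere on the range of the covariance for every [s]. The
    exceptional set is therefore empty. *)
Lemma ae_sum_aligned_neq0 (i0 : 'I_N) :
  {ae P, forall w, \sum_n aligned c (phi th) (observation X w n) != 0}.
Proof.
pose g (t : 4.-tuple R) := aligned c (phi th) (col_of_tuple t).
have mg : measurable_fun setT g by exact: measurable_aligned.
have mgX n : measurable_fun setT (fun w => g (X n w)).
  exact: (measurableT_comp mg (measurable_funPT (X n))).
have mS : measurable_fun setT (fun w => \sum_(n | n != i0) g (X n w)).
  under eq_fun do rewrite big_mkcond /=.
  apply: measurable_sum => n.
  by case: (n != i0); [exact: mgX | exact: measurable_cst].
apply: ae_neq0; first exact: measurable_sum.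
pose S : {mfun T >-> R} := HB.pack (fun w => \sum_(n | n != i0) g (X n w))
  (isMeasurableFun.Build _ _ _ _ _ mS).
pose D : set (R * 4.-tuple R) := [set st | st.1 + g st.2 = 0].
have -> : [set w | \sum_n aligned c (phi th) (observation X w n) = 0] =
    [set w | D (S w, X i0 w)].
  have E w : \sum_n aligned c (phi th) (observation X w n) = S w + g (X i0 w).
    by rewrite (bigD1 i0) //= addrC.
  by apply/seteqP; split => w /=; rewrite E.
apply: (@indep_null _ _ _ P _ _ _ _ S (X i0) D set0) => //.
- by move=> A B mA mB; exact: indep_sum.
- apply: measurable_zeros; apply: measurable_funD; first exact: measurable_fst.
  exact: (measurableT_comp mg measurable_snd).
- by rewrite preimage_set0 measure0.
move=> s _; apply: (gaussian_zeros (h := fun v => s + aligned c (phi th) v) (gaussX i0)).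
- by apply: line_polynomial_add; [exact: line_polynomial_cst | exact: line_polynomial_aligned].
- by apply: measurable_funD; [exact: measurable_cst | exact: measurable_aligned].
have [s0|s0] := eqVneq s 0; last first.
  exists 0; rewrite mulmx0 /aligned /rc /rs /I1 /I2 /Q1 /Q2 !mxE.
  by case: (c); rewrite !(mul0r, mulr0, subr0, addr0).
set C := cos (phi th); set C' := sin (phi th).
(* This is z1 = 1, z2 = e^(i phi), which [Sigma] sends to sigma1^2 + cross and (sigma2^2 + cross)
   e^(i phi), both nonzero and already aligned with phi. *)
exists (col4 (1, 0, C, C')).
have [e1 e2 e3 e4] := Sigma_mulE c th 1 0 C C'.
have CC : C ^+ 2 + C' ^+ 2 = 1 by exact: cos2Dsin2.
have [s10 s20 r0 _] := th_feasible.
have k0 : 0 <= cross th by rewrite /cross !mulr_ge0.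
suff -> : s + aligned c (phi th) (Sigma c th *m col4 (1, 0, C, C')) =
    (sigma1 th ^+ 2 + cross th) * (sigma2 th ^+ 2 + cross th).
  by rewrite mulf_neq0 // gt_eqF // ltr_wpDr // exprn_gt0.
rewrite s0 add0r /aligned -/C -/C'.
have f1 : I1 (Sigma c th *m col4 (1, 0, C, C')) = sigma1 th ^+ 2 + cross th.
  transitivity (sigma1 th ^+ 2 + cross th * (C ^+ 2 + C' ^+ 2)).
    by rewrite e1 -/C -/C'; ring.
  by rewrite CC mulr1.
have f2 : Q1 (Sigma c th *m col4 (1, 0, C, C')) = 0.
  by rewrite e2 -/C -/C'; ring.
have f3 : I2 (Sigma c th *m col4 (1, 0, C, C')) = (sigma2 th ^+ 2 + cross th) * C.
  by rewrite e3 -/C -/C'; ring.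
have f4 : Q2 (Sigma c th *m col4 (1, 0, C, C')) = (sigma2 th ^+ 2 + cross th) * C'.
  by rewrite e4 -/C -/C'; ring.
rewrite /rc /rs f1 f2 f3 f4 -[RHS]mulr1 -CC.
by case: (c); ring.
Qed.

(** A zero mean power would make I1 or I2 of the first sample vanish, and R = 0 would make the
    aligned sum vanish; each is a null event. *)
Lemma ae_closed_form_defined : (0 < N)%N ->
  {ae P, forall w, closed_form_defined c (observation X w)}.
Proof.
move=> N0; pose i0 := Ordinal N0.
apply: filterS3 (ae_I1_neq0 i0) (ae_I2_neq0 i0) (ae_sum_aligned_neq0 i0).
move=> w I1n0 I2n0 g0; split.
- apply: contraNneq I1n0 => /(mean_eq0 N0) H.
  have /eqP := H (fun n => addr_ge0 (sqr_ge0 _) (sqr_ge0 _)) i0.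
  by rewrite paddr_eq0 ?sqr_ge0 // !sqrf_eq0 => /andP[].
- apply: contraNneq I2n0 => /(mean_eq0 N0) H.
  have /eqP := H (fun n => addr_ge0 (sqr_ge0 _) (sqr_ge0 _)) i0.
  by rewrite paddr_eq0 ?sqr_ge0 // !sqrf_eq0 => /andP[].
apply: contraNneq g0 => -[Rc0 Rs0].
have /eqP := aligned_mean c (phi th) (observation X w).
by rewrite Rc0 Rs0 !mulr0 addr0 mulf_eq0 invr_eq0 pnatr_eq0 eqn0Ngt N0 orbF.
Qed.

(** As [rho th < 1], [Sigma] is invertible and its range is the whole space. Given sample [i] with
    I1 != 0, the minor is a polynomial in sample [j] whose value at (0, 0, 1, 0) is - I1. *)
Lemma ae_minor_neq0 i j : i != j -> rho th < 1 ->
  {ae P, forall w, minor_re c (observation X w i) (observation X w j) != 0}.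
Proof.
move=> ij r1; have mm := measurable_minor (R := R) c.
apply: ae_neq0.
  have mX : measurable_fun setT (fun w => (X i w, X j w)).
    by apply: measurable_fun_pair; exact: measurable_funPT.
  exact: (measurableT_comp mm mX).
have uS : Sigma c th \in unitmx.
  have [s10 s20 r0 _] := th_feasible.
  rewrite SigmaE block44_unit.
  have -> : sigma1 th ^+ 2 * sigma2 th ^+ 2 - cross th ^+ 2
    = sigma1 th ^+ 2 * sigma2 th ^+ 2 * (1 - rho th ^+ 2) by rewrite /cross; ring.
  rewrite !mulf_neq0 ?(gt_eqF s1_gt0) ?(gt_eqF s2_gt0) //.
  by rewrite subr_eq0 eq_sym lt_eqF // expr_lt1.
apply: (@indep_null _ _ _ P _ _ _ _ (X i) (X j)
  [set s | minor_re c (col_of_tuple s.1) (col_of_tuple s.2) = 0]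
  [set s | I1 (col_of_tuple s) = 0]).
- by move=> A B mA mB; exact: indep_pair.
- exact: measurable_zeros.
- by apply: measurable_zeros; exact: measurable_col_entry.
- apply: (gaussian_zeros (gaussX i) (line_polynomial_entry (inord 0) 0)).
    exact: measurable_col_entry.
  exists (col4 (1, 0, 0, 0)); have [e _ _ _] := Sigma_mulE c th 1 0 0 0.
  by rewrite -/(I1 _) e !mulr0 !addr0 mulr1 expf_neq0 // gt_eqF.
move=> s Is; apply: (gaussian_zeros (gaussX j) (line_polynomial_minor c (col_of_tuple s))).
  exact: (measurable_fun_pair2 s mm).
exists (invmx (Sigma c th) *m col4 (0, 0, 1, 0)); rewrite mulKVmx //.
have [e1 e2 e3 e4] := col4E (0 : R) 0 1 0.
rewrite /minor_re e1 e2 e3 e4 !(mulr0, mul0r, add0r, addr0) mul1r oppr_eq0.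
exact/eqP.
Qed.

End almost_sure.

Theorem proposition1 (R : realType) (d : measure_display)
    (T : measurableType d) (P : probability T R) (c : radar) (N : nat)
    (hN : (0 < N)%N) (th0 : params R) (hth0 : feasible th0)
    (X : 'I_N -> {RV P >-> 4.-tuple R})
    (hindep : independent_samples X)
    (hgauss : forall n, centered_gaussian (X n) (Sigma c th0)) :
  [/\ forall w, closed_form_defined c (observation X w) ->
        mfn_estimators c (observation X w) = closed_form c (observation X w),
      forall w, closed_form_defined c (observation X w) ->
        rho_hat c (observation X w) < 1 ->
        ml_estimators c (observation X w) = closed_form c (observation X w),
      0 < sigma1 th0 -> 0 < sigma2 th0 ->
        {ae P, forall w, closed_form_defined c (observation X w) /\
          mfn_estimators c (observation X w)
            = closed_form c (observation X w)} &
      0 < sigma1 th0 -> 0 < sigma2 th0 -> rho th0 < 1 -> (1 < N)%N ->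
        {ae P, forall w,
          mfn_estimators c (observation X w)
            = closed_form c (observation X w) /\
          ml_estimators c (observation X w)
            = closed_form c (observation X w)}].
Proof.
split=> [w|w|s1 s2|s1 s2 r1 N1].
- exact: mfn_closed_form.
- exact: ml_closed_form.
- apply: filterS (ae_closed_form_defined hindep hgauss hth0 s1 s2 hN) => w cfd.
  by split=> //; exact: mfn_closed_form.
(* Samples 0 and 1 supply the minor that certifies [rho_hat] below 1. *)
have ij : Ordinal hN != Ordinal N1 by [].
apply: filterS2 (ae_closed_form_defined hindep hgauss hth0 s1 s2 hN)
  (ae_minor_neq0 hindep hgauss hth0 s1 s2 ij r1) => w cfd minor.
split; first exact: mfn_closed_form.
apply: ml_closed_form => //; have [P10 P20 _] := cfd.
exact: (rho_hat_lt1 hN P10 P20 minor).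
Qed.
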